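(* Let $V$ be a finite set of boxes with size function $w:V\to[0,1]^d$, let $(G_1,\dots,G_d)$ with $G_i=(V,E_i)$ be a packing class for $(V,w)$, let $w'$ be a conservative scale for $(V,w)$, let $i\in\{1,\dots,d\}$ and $S\subseteq V$. Then the induced subgraph $G_i[S]$ contains a clique of cardinality $\lceil\sum_{b\in S}w'_i(b)\rceil$.
   Context: For a size function $w$ and coordinate $i$, $\mathcal F(V,w_i)=\{S\subseteq V:\sum_{b\in S}w_i(b)\le1\}$. A packing class for $(V,w)$ is a $d$-tuple of graphs $G_i=(V,E_i)$ such that each $G_i$ is an interval graph, every stable set of $G_i$ lies in $\mathcal F(V,w_i)$, and $\bigcap_{i=1}^dE_i=\emptyset$. A function $w':V\to\mathbb R_{\ge0}^d$ is a conservative scale for $(V,w)$ if $\mathcal F(V,w_i)\subseteq\mathcal F(V,w'_i)$ for all $i$. *)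

(* Defs.v *)
From HB Require Import structures.
From mathcomp Require Import all_boot all_order all_algebra.
From mathcomp Require Import reals.

Set Implicit Arguments.
Unset Strict Implicit.
Unset Printing Implicit Defensive.

Import Order.TTheory GRing.Theory Num.Theory.
Local Open Scope ring_scope.

Record graph (T : finType) := Graph {
  edges : {set {set T}};
  card_edge : forall e : {set T}, e \in edges -> #|e| = 2%N }.

(* [adj G v v] is false, since [set v; v] has only one element. *)
Definition adj (T : finType) (G : graph T) (u v : T) : bool :=
  [set u; v] \in edges G.

Definition stable (T : finType) (G : graph T) (C : {set T}) : Prop :=
  forall u v : T, u \in C -> v \in C -> ~~ adj G u v.

Definition clique (T : finType) (G : graph T) (C : {set T}) : Prop :=
  forall u v : T, u \in C -> v \in C -> u != v -> adj G u v.

Definition induced_edges (T : finType) (G : graph T) (S : {set T}) :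
    {set {set {x : T | x \in S}}} :=
  [set e : {set {x : T | x \in S}} | val @: e \in edges G].

Lemma card_induced_edge (T : finType) (G : graph T) (S : {set T})
    (e : {set {x : T | x \in S}}) : e \in induced_edges G S -> #|e| = 2%N.
Proof.
by rewrite inE => /card_edge; rewrite card_imset //; exact: val_inj.
Qed.

Definition induced (T : finType) (G : graph T) (S : {set T}) :
    graph {x : T | x \in S} :=
  Graph (@card_induced_edge T G S).

(* The representing intervals are nonempty; each endpoint may be open, closed
   or infinite. *)
Definition interval_graph (R : realType) (T : finType) (G : graph T) : Prop :=
  exists I : T -> interval R,
    (forall v : T, exists x : R, x \in I v) /\
    (forall u v : T, u != v ->
       (adj G u v <-> exists x : R, x \in I u /\ x \in I v)).

Definition feasible (R : realType) (V : finType) (g : V -> R) :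
    {set {set V}} :=
  [set S : {set V} | \sum_(b in S) g b <= 1].

Definition packing_class (R : realType) (V : finType) (d : nat)
    (w : V -> 'I_d -> R) (G : 'I_d -> graph V) : Prop :=
  [/\ forall i : 'I_d, interval_graph R (G i),
      forall (i : 'I_d) (C : {set V}),
        stable (G i) C -> C \in feasible (fun b => w b i)
    & \bigcap_(i < d) edges (G i) = set0].

Definition conservative_scale (R : realType) (V : finType) (d : nat)
    (w w' : V -> 'I_d -> R) : Prop :=
  (forall (b : V) (i : 'I_d), 0 <= w' b i) /\
  (forall i : 'I_d,
     feasible (fun b => w b i) \subset feasible (fun b => w' b i)).

(* Main.v *)
(* Interval graphs are perfect: colouring the vertices greedily by increasing
   left endpoint uses no more colours than some clique has vertices, because
   every vertex forms a clique together with its earlier neighbours.  Each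
   colour class is stable, hence has w'_i-weight at most 1 because w' is a
   conservative scale; so the weight of S is at most the size of a clique of
   G_i[S]. *)
Require Import Defs.
From HB Require Import structures.
From mathcomp Require Import all_boot all_order all_algebra.
From mathcomp Require Import reals.

Set Implicit Arguments.
Unset Strict Implicit.
Unset Printing Implicit Defensive.

Import Order.TTheory GRing.Theory Num.Theory.
Local Open Scope ring_scope.

Section Graphs.
Variable T : finType.
Implicit Types (G : graph T) (C D S : {set T}).

Lemma adjC G : symmetric (adj G).
Proof. by move=> u v; rewrite /adj setUC. Qed.

Lemma adjxx G u : adj G u u = false.
Proof.
by apply/negP => /card_edge; rewrite setUid cards1.
Qed.

Lemma clique_subset G C D : D \subset C -> clique G C -> clique G D.
Proof. by move=> /subsetP sDC clC u v /sDC uC /sDC vC; exact: clC. Qed.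

Lemma adj_induced G S (u v : {x : T | x \in S}) :
  adj (induced G S) u v = adj G (val u) (val v).
Proof. by rewrite /adj inE imsetU1 imset_set1. Qed.

(** Used to trim a clique that is too large to the exact cardinality required. *)
Lemma exists_subset_card C m :
  (m <= #|C|)%N -> exists2 D : {set T}, D \subset C & #|D| = m.
Proof.
move=> le_m; exists [set x in take m (enum C)].
  by apply/subsetP => x; rewrite inE => /mem_take; rewrite mem_enum.
rewrite cardsE; have /card_uniqP -> : uniq (take m (enum C)).
  by rewrite take_uniq // enum_uniq.
by rewrite size_takel // -cardE.
Qed.

Lemma clique_induced G S C : C \subset S -> clique G C ->
  exists2 D : {set {x : T | x \in S}}, clique (induced G S) D & #|D| = #|C|.
Proof.
move=> /subsetP sCS clC; exists [set x | val x \in C].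
  by move=> u v; rewrite !inE adj_induced => uC vC neq_uv; apply: clC.
rewrite -(card_imset _ val_inj); congr #|pred_of_set _|.
apply/setP => x; apply/imsetP/idP => [[y + ->]|xC]; first by rewrite inE.
by exists (Sub x (sCS x xC)); rewrite ?inE.
Qed.

(** Pigeonhole: [c] takes at most [#|C|] values on [C], so it misses one of [0, ..., #|C|]. *)
Lemma exists_fresh_color (c : T -> nat) C :
  exists2 j, (j <= #|C|)%N & forall u, u \in C -> c u != j.
Proof.
have [/allP used|/allPn[j]] :=
    boolP (all (mem [seq c u | u in C]) (iota 0 #|C|.+1)).
  have /(uniq_leq_size (iota_uniq _ _)) := used.
  by rewrite size_iota size_image ltnn.
rewrite mem_iota add0n ltnS => /= le_j cNj; exists j => // u uC.
by apply: contra cNj => /eqP <-; apply: image_f.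
Qed.

(** Stated inside [T] rather than on [induced G S], so that deleting vertices changes only a set and
    not the vertex type. *)
Definition simplicial_in G S v :=
  clique G [set u in S | (u == v) || adj G v u].

(** Induction on [#|S|]: delete a simplicial vertex [v], colour the rest, then give [v] a colour
    missing among its neighbours. *)
Lemma greedy_coloring G S :
  (forall S', S' != set0 -> exists2 v, v \in S' & simplicial_in G S' v) ->
  exists C (c : T -> nat),
    [/\ C \subset S, clique G C, forall u, u \in S -> (c u < #|C|)%N
      & forall u v, u \in S -> v \in S -> adj G u v -> c u != c v].
Proof.
move=> simpl; have [n le_n] := ubnP #|S|.
elim: n S le_n => // n IHn S; rewrite ltnS => le_n.
have [->|/simpl[v vS simpl_v]] := eqVneq S set0.
  exists set0, (fun=> 0%N).
  by split=> [|u w|u|u w]; rewrite ?sub0set ?inE.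
have [|C [c [sCS clC c_lt c_proper]]] := IHn (S :\ v).
  by apply: leq_trans le_n; rewrite [X in (_ < X)%N](cardsD1 v) vS.
set N := [set u in S | adj G v u].
have [j le_j jN] := exists_fresh_color c N.
set K := [set u in S | (u == v) || adj G v u] in simpl_v *.
(* Since [v] itself belongs to [K], the bound [j <= #|N|] becomes [j < #|K|]. *)
have cardK : #|K| = #|N|.+1.
  have -> : K = v |: N.
    by apply/setP => u; rewrite !inE; case: eqP => //= ->; rewrite vS.
  by rewrite cardsU1 inE adjxx andbF.
have sKS : K \subset S by apply/subsetP => u; rewrite inE => /andP[].
have sCS' : C \subset S by apply: subset_trans sCS _; apply: subD1set.
(* The larger of the two cliques bounds both the old colours and the colour of [v]. *)
exists (if (#|K| <= #|C|)%N then C else K),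
  (fun u => if u == v then j else c u).
have card_max : #|if (#|K| <= #|C|)%N then C else K| = maxn #|K| #|C|.
  by case: leqP => // ?; rewrite (maxn_idPl _) // ltnW.
split; [by case: ifP | by case: ifP | |].
- move=> u uS; rewrite card_max leq_max.
  have [_|neq_uv] := eqVneq u v; first by rewrite cardK ltnS le_j.
  by rewrite c_lt ?orbT // !inE neq_uv.
- move=> u x uS xS; have [->|neq_uv] := eqVneq u v.
    have [->|neq_xv] := eqVneq x v; first by rewrite adjxx.
    by move=> adj_vx; rewrite eq_sym jN // inE xS.
  have [->|neq_xv] := eqVneq x v.
    by rewrite adjC => adj_vu; rewrite jN // inE uS.
  by apply: c_proper; rewrite !inE ?neq_uv ?neq_xv.
Qed.

Lemma interval_graph_simplicial (R : realType) G S :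
  interval_graph R G -> S != set0 ->
  exists2 v, v \in S & simplicial_in G S v.
Proof.
move=> [I [I_neq0 adjP]] /set0Pn[v0 v0S].
(* Left endpoints are compared as interval bounds, a total order that also covers open, closed and
   infinite ends. *)
pose left_end v := let: Interval l _ := I v in l.
have [v vS v_max] := arg_maxP left_end v0S.
exists v => // u x; rewrite !inE => /andP[uS uv] /andP[xS xv] neq_ux.
have meets y : (y == v) || adj G v y -> exists a, a \in I v /\ a \in I y.
  have [-> _|neq_yv /= adj_vy] := eqVneq y v.
    by have [a ?] := I_neq0 v; exists a.
  by apply/adjP; rewrite // eq_sym.
(* Of two points of [I v], the smaller one lies in every interval of S that
   contains the larger one, since no left endpoint exceeds that of [I v]. *)
have common a b y : y \in S -> a \in I v -> b \in I y -> a <= b -> a \in I y.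
  move=> /v_max; rewrite /left_end.
  case: (I v) (I y) => [l r] [l' r'] /= le_l.
  rewrite !itv_boundlr => /andP[l_a _] /andP[_ b_r'] le_ab.
  rewrite (le_trans le_l l_a) /=.
  by apply: le_trans b_r'; rewrite bnd_simp.
have [a [av au]] := meets u uv; have [b [bv bx]] := meets x xv.
apply/adjP => //; have [le_ab|/ltW le_ba] := leP a b.
  by exists a; split=> //; apply: common bx le_ab.
by exists b; split=> //; apply: common au le_ba.
Qed.

Lemma sum_le_coloring (R : realType) G S (f : T -> R) (c : T -> nat) k :
    (forall C, stable G C -> \sum_(b in C) f b <= 1) ->
    (forall u, u \in S -> (c u < k)%N) ->
    (forall u v, u \in S -> v \in S -> adj G u v -> c u != c v) ->
  \sum_(b in S) f b <= k%:R.
Proof.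
move=> f_le1 c_lt c_proper.
(* Each [b] in [S] has exactly one colour below [k]; exchanging the sums then groups the weights by
   colour class. *)
have -> : \sum_(b in S) f b = \sum_(b in S) \sum_(j < k | c b == j) f b.
  apply: eq_bigr => b bS; rewrite (big_pred1 (Ordinal (c_lt b bS))) //.
rewrite (exchange_big_dep predT) //=.
rewrite -[k in k%:R]card_ord -sumr_const; apply: ler_sum => j _.
have -> : \sum_(b in S | c b == j) f b =
    \sum_(b in [set b in S | c b == j]) f b.
  by apply: eq_bigl => b; rewrite inE.
apply: f_le1 => u v; rewrite !inE => /andP[uS /eqP cu] /andP[vS /eqP cv].
by apply/negP => /(c_proper _ _ uS vS); rewrite cu cv eqxx.
Qed.

End Graphs.

Theorem theorem16 (R : realType) (V : finType) (d : nat)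
    (w : V -> 'I_d -> R)
    (hw : forall (b : V) (i : 'I_d), 0 <= w b i <= 1)
    (G : 'I_d -> graph V) (hG : packing_class w G)
    (w' : V -> 'I_d -> R) (hw' : conservative_scale w w')
    (i : 'I_d) (S : {set V}) :
  exists C : {set {b : V | b \in S}},
    clique (induced (G i) S) C /\
    (#|C|)%:Z = Num.ceil (\sum_(b in S) w' b i).
Proof.
have [G_itv G_stable _] := hG; have [w'_ge0 sub_w'] := hw'.
have [C [c [sCS clC c_lt c_proper]]] :=
  @greedy_coloring _ _ S (fun S' => interval_graph_simplicial (G_itv i)).
have sum_le : \sum_(b in S) w' b i <= #|C|%:R.
  apply: sum_le_coloring c_lt c_proper => D /G_stable /(subsetP (sub_w' i)).
  by rewrite inE.
have ceil_ge0 : 0 <= Num.ceil (\sum_(b in S) w' b i).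
  by rewrite -(ceil0 R) le_ceil // sumr_ge0.
(* An integer upper bound of the sum also bounds its ceiling, so [C] can be cut down to that
   size. *)
have le_card : (`|Num.ceil (\sum_(b in S) w' b i)| <= #|C|)%N.
  by rewrite -lez_nat gez0_abs // ceil_le_int.
have [D sDC cardD] := exists_subset_card le_card.
have [E clE cardE] :=
  clique_induced (subset_trans sDC sCS) (clique_subset sDC clC).
by exists E; split=> //; rewrite cardE cardD gez0_abs.
Qed.
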